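(* If $C$ is a caterpillar of order $n$, then $\alpha_{bn}(C)\le n-|B_C|+\alpha(C[R_C])$.
   Context: A caterpillar is a tree with a diametrical path such that every vertex lies on that path or is adjacent to a vertex on it. For a tree $T$: $B_T$ is the set of branch vertices (degree at least 3), $L_T$ the set of leaves, $\tau_T$ the set of vertices of degree 2 (trunks). The branch-leaf representation $\mathcal{BL}(T)$ is obtained from $T$ by repeatedly deleting a vertex of degree 2 and joining its two neighbours by an edge until no vertex of degree 2 remains. $R_T\subseteq B_T$ is the set of branch vertices that are adjacent to at most one leaf in $\mathcal{BL}(T)$ (equivalently, $b\in B_T$ is in $R_T$ iff there is at most one leaf $l\in L_T$ such that for every $b'\in B_T\setminus\{b\}$ the unique $b'$–$l$ path contains $b$). $T[R_T]$ is the subgraph induced by $R_T$ and $\alpha(\cdot)$ denotes independence number (taken as $0$ for the empty graph). A broadcast on a connected graph $G$ is a function $f:V(G)\to\{0,1,\dots,\operatorname{diam}(G)\}$ with $f(v)\le e(v)$ (the eccentricity of $v$). Let $V_f^+=\{v: f(v)>0\}$. A vertex $u$ hears $f$ from $v\in V_f^+$ if $d_G(u,v)\le f(v)$; $N_f(v)$ is the set of vertices hearing $f$ from $v$ (including $v$), $PN_f(v)$ the set of vertices hearing $f$ only from $v$, and $B_f(v)=\{u\in N_f(v): d_G(u,v)=f(v)\}$. The broadcast $f$ is boundary independent if $N_f(v)\setminus B_f(v)\subseteq PN_f(v)$ for all $v\in V_f^+$. The cost is $\sigma(f)=\sum_v f(v)$, and $\alpha_{bn}(G)$ is the maximum cost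 of a boundary independent broadcast on $G$. *)

(* Defs.v *)
From mathcomp Require Import all_boot.

Set Implicit Arguments.
Unset Strict Implicit.
Unset Printing Implicit Defensive.

(* Finite simple graphs are given by a symmetric irreflexive [e : rel V] on a
   finite type.  [fgraph V] is a graph whose vertex set may be a proper subset
   of [V]; it is used for induced subgraphs and for the branch-leaf
   representation, which both live on subsets of the vertices of the tree. *)
Record fgraph (V : finType) := FGraph { vset : {set V}; adj : rel V }.

Definition whole (V : finType) (e : rel V) : fgraph V := FGraph [set: V] e.

Section Graphs.
Variables (V : finType) (G : fgraph V).

Definition nbrs (v : V) : {set V} := [set u in vset G | adj G v u].
Definition degree (v : V) : nat := #|nbrs v|.

Definition leaves : {set V} := [set v in vset G | degree v == 1].
Definition trunks : {set V} := [set v in vset G | degree v == 2].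
Definition branches : {set V} := [set v in vset G | 3 <= degree v].

Definition induced (A : {set V}) : fgraph V :=
  FGraph (vset G :&: A)
    [rel x y | [&& x \in vset G :&: A, y \in vset G :&: A & adj G x y]].

Definition independent (S : {set V}) : bool :=
  (S \subset vset G) && [forall x in S, forall y in S, ~~ adj G x y].

Definition indep_num : nat := \max_(S : {set V} | independent S) #|S|.

(* Delete [v] and join its neighbours to each other; used when [v] has exactly
   two neighbours. *)
Definition suppress (v : V) : fgraph V :=
  let A := vset G :\ v in
  FGraph A
    [rel x y | [&& x \in A, y \in A &
       adj G x y || [&& x != y, x \in nbrs v & y \in nbrs v]]].

Definition suppress_step : fgraph V :=
  if [pick v in trunks] is Some v then suppress v else G.

End Graphs.

(* [#|V|] steps are enough to exhaust the degree 2 vertices: see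
   [trunks_branch_leaf_rep] below.  In a tree, suppression preserves the degrees
   of the remaining vertices, so the order of the deletions is irrelevant. *)
Definition branch_leaf_rep (V : finType) (e : rel V) : fgraph V :=
  iter #|V| (@suppress_step V) (whole e).

Lemma trunks_branch_leaf_rep (V : finType) (e : rel V) :
  trunks (branch_leaf_rep e) = set0.
Proof.
suff H k (G : fgraph V) : #|vset G| <= k ->
    trunks (iter k (@suppress_step V) G) = set0.
  by apply: H; rewrite cardsT.
elim: k G => [|k IHk] G hG.
  move: hG; rewrite leqn0 cards_eq0 => /eqP G0.
  by apply/setP=> v; rewrite !inE G0 inE.
rewrite iterSr /suppress_step; case: pickP => [v|noV].
  rewrite inE => /andP[vG _]; apply: IHk => /=.
  by rewrite (cardsD1 v) vG in hG.
have T0 : trunks G = set0 by apply/setP=> v; rewrite noV inE.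
suff -> : iter k (@suppress_step V) G = G by [].
elim: k {IHk hG} => //= k ->.
by rewrite /suppress_step; case: pickP => // v; rewrite noV.
Qed.

Section Trees.
Variables (V : finType) (e : rel V).

Definition simple_graph : Prop := symmetric e /\ irreflexive e.

(* The default value [#|V|] is only reached when [y] is not reachable from [x],
   since a shortest path has length less than [#|V|]. *)
Definition dist (x y : V) : nat :=
  \big[minn/#|V|]_(k < #|V| |
     [exists p : k.-tuple V, path e x p && (last x p == y)]) k.

Definition ecc (v : V) : nat := \max_(u : V) dist v u.
Definition diam : nat := \max_(v : V) ecc v.

Definition tree : Prop :=
  [/\ simple_graph, 0 < #|V|, forall x y : V, connect e x y &
      forall c : seq V, 2 < size c -> ~ ucycle e c].

Definition diametrical_path (x : V) (p : seq V) : Prop :=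
  [/\ path e x p, uniq (x :: p), size p = diam & dist x (last x p) = diam].

Definition caterpillar : Prop :=
  tree /\ exists (x : V) (p : seq V),
    diametrical_path x p /\
    forall v : V, v \in x :: p \/ exists2 w, w \in x :: p & e v w.

(* The set denoted R_T: branch vertices adjacent to at most one leaf in BL(T). *)
Definition sparse_branches : {set V} :=
  let H := branch_leaf_rep e in
  [set b in branches (whole e) | #|nbrs H b :&: leaves H| <= 1].

End Trees.

Section Broadcasts.
Variables (V : finType) (e : rel V).

Definition bfun : finType := {ffun V -> 'I_(diam e).+1}.

Definition broadcast (f : bfun) : bool := [forall v, f v <= ecc e v].

Section Fixed.
Variable f : bfun.

Definition broadcasting : {set V} := [set v | 0 < f v].

Definition hears (u v : V) : bool := (v \in broadcasting) && (dist e u v <= f v).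

Definition bnbhd (v : V) : {set V} := [set u | hears u v].

Definition private_nbhd (v : V) : {set V} :=
  [set u in bnbhd v | [forall w, hears u w ==> (w == v)]].

Definition bboundary (v : V) : {set V} := [set u in bnbhd v | dist e u v == f v].

Definition boundary_independent : bool :=
  [forall v in broadcasting, bnbhd v :\: bboundary v \subset private_nbhd v].

Definition cost : nat := \sum_(v : V) f v.

End Fixed.

Definition alpha_bn : nat :=
  \max_(f : bfun | broadcast f && boundary_independent f) cost f.

End Broadcasts.

(* Main.v *)
(* Send each spine vertex to itself if it is not a branch vertex, and otherwise
   to its pendant neighbours. Distinct broadcasters [v] have disjoint sets of
   spine vertices at distance less than [f v], and the corresponding vertices,
   together with [v] itself if [v] is off the spine, are at least [f v] vertices
   outside [B_C], except when [f v = 2] and [v] is the only pendant neighbour of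
   its host [b]. In that case two vertices are needed but only [v] is found. If
   [b] is in [R_C], take [b]; such hosts are pairwise non-adjacent, so there are
   at most [alpha(C[R_C])] of them. Otherwise [b] is the first or the last branch
   vertex, and the next spine vertex outwards is not used by anyone else. *)
Require Import Defs.
From mathcomp Require Import all_boot zify.

Set Implicit Arguments.
Unset Strict Implicit.
Unset Printing Implicit Defensive.

(** * Walks and distances *)

Section Walks.
Variables (V : finType) (e : rel V).

Definition walk (k : nat) (x y : V) : Prop :=
  exists p, [/\ path e x p, last x p = y & size p = k].

Lemma walk0 x : walk 0 x x.
Proof. by exists [::]. Qed.

Lemma walk1 x y : e x y -> walk 1 x y.
Proof. by move=> xy; exists [:: y]; rewrite /= xy. Qed.

Lemma walk_trans k l y x z : walk k x y -> walk l y z -> walk (k + l) x z.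
Proof.
move=> [p [pP lp sp]] [q [qP lq sq]]; exists (p ++ q).
by rewrite cat_path last_cat lp pP qP size_cat sp sq.
Qed.

Lemma walk_sym k x y : symmetric e -> walk k x y -> walk k y x.
Proof.
move=> symE [p [pP lp sp]]; exists (rev (belast x p)); split.
- rewrite -lp rev_path; apply: sub_path pP => a b; by rewrite symE.
- by case: p pP lp sp => [|a p] //= _ lp _; rewrite rev_cons last_rcons.
- by rewrite size_rev size_belast.
Qed.

Lemma dist_le_walk k x y : walk k x y -> dist e x y <= k.
Proof.
have bigmin_le (r : seq 'I_#|V|) (P : pred 'I_#|V|) i : i \in r -> P i ->
    \big[minn/#|V|]_(j <- r | P j) j <= i.
  elim: r => // a r IHr; rewrite inE big_cons => /predU1P[<- ->|ir Pi].
    exact: geq_minl.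
  case: ifP => _; last exact: IHr.
  exact: leq_trans (geq_minr _ _) (IHr ir Pi).
(* The default value bounds [dist], which settles walks too long to occur in the minimum. *)
have dist_le_card : dist e x y <= #|V|.
  rewrite /dist; elim/big_rec: _ => [//|i m _ mV].
  by rewrite geq_min mV orbT.
move=> [p [pP lp sp]]; case: (ltnP k #|V|) => kV; last first.
  exact: leq_trans dist_le_card kV.
have := @bigmin_le (index_enum _) _ (Ordinal kV); apply.
  exact: mem_index_enum.
have sp' : size p == k by apply/eqP.
by apply/existsP; exists (Tuple sp'); rewrite /= pP lp eqxx.
Qed.

(** The strict bound excludes the default value, so the minimum is attained. *)
Lemma dist_walk x y : dist e x y < #|V| -> walk (dist e x y) x y.
Proof.
suff : dist e x y = #|V| \/ walk (dist e x y) x y.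
  by case=> [-> | //]; rewrite ltnn.
rewrite /dist; elim/big_ind: _ => [|m k m_ k_|i /existsP[p /andP[pP /eqP lp]]].
- by left.
- by case: (leqP m k).
- by right; exists p; rewrite size_tuple.
Qed.

Lemma dist_le_diam x y : dist e x y <= diam e.
Proof.
apply: (@leq_trans (ecc e x)).
  exact: (leq_bigmax y (F := dist e x)).
exact: (leq_bigmax x (F := ecc e)).
Qed.

End Walks.

(** * Coordinates along a diametrical path *)

(* [d] is the length of the spine [s 0, ..., s d]; [pos v] is the index of [v]
   if [v] lies on the spine, and that of the neighbour of [v] otherwise. *)
Record spine_coordinates (V : finType) (e : rel V) (d : nat) (s : nat -> V)
    (pos : V -> nat) (sp : pred V) : Prop := SpineCoordinates {
  spineK : forall i, i <= d -> sp (s i) /\ pos (s i) = i;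
  spine_posK : forall v, sp v -> pos v <= d /\ s (pos v) = v;
  pendant_pos : forall v, ~~ sp v -> 0 < pos v < d;
  adjE : forall x y, e x y =
    if sp x && sp y then (pos x == (pos y).+1) || (pos y == (pos x).+1)
    else (sp x (+) sp y) && (pos x == pos y) }.

(** The dominating diametrical path serves as spine. Being shortest between its ends, it has no
    chords and no pendants at its ends; acyclicity gives each other vertex a single spine neighbour
    and forbids edges between two vertices off the spine. *)
Lemma caterpillar_coordinates (V : finType) (e : rel V) : caterpillar e ->
  exists s pos sp, spine_coordinates e (diam e) s pos sp.
Proof.
move=> [[[symE irrE] V0 conE acyc] [x [p [[pP pU psz pd] pdom]]]].
pose S := x :: p; pose s := nth x S; set d := diam e in psz pd *.
pose pos v := if v \in S then index v S else find (e v) S.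
have sizeS : size S = d.+1 by rewrite /= psz.
have s_in i : i <= d -> s i \in S by move=> id; rewrite mem_nth ?sizeS.
have s_inj i j : i <= d -> j <= d -> s i = s j -> i = j.
  by move=> id jd /eqP; rewrite nth_uniq ?sizeS // => /eqP.
have sadj i : i < d -> e (s i) (s i.+1).
  by move=> id; move/(pathP x): pP; apply; rewrite psz.
have spath i n : i + n <= d ->
    path e (s i) (map s (iota i.+1 n)) /\
    last (s i) (map s (iota i.+1 n)) = s (i + n).
  elim: n i => [|n IHn] i; first by rewrite addn0.
  rewrite addnS -addSn => h; have [h1 h2] := IHn _ h.
  by rewrite /= h1 sadj //; lia.
have swalk i j : i <= j <= d -> walk e (j - i) (s i) (s j).
  move=> /andP[ij jd]; have [|h1 h2] := spath i (j - i); first by lia.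
  exists (map s (iota i.+1 (j - i))); rewrite h2 size_map size_iota subnKC //.
have d_le k : walk e k (s 0) (s d) -> d <= k.
  move/dist_le_walk; suff -> : dist e (s 0) (s d) = d by [].
  by rewrite -[RHS]pd /s -psz (last_nth x).
(* The edge as a shortcut gives a walk of length [i + 1 + (d - j)] between the ends, which is at
   least [d]. *)
have chord i j : i < j <= d -> e (s i) (s j) -> j = i.+1.
  move=> ij eij; have := walk_trans (swalk 0 i _) (walk_trans (walk1 eij) (swalk j d _)).
  by move=> /(_ ltac:(lia) ltac:(lia)) /d_le; lia.
have suniq i n : i + n <= d -> uniq (map s (iota i n.+1)).
  move=> h; rewrite map_inj_in_uniq ?iota_uniq // => a b.
  by rewrite !mem_iota => ha hb; apply: s_inj; lia.
have snotin v i n : v \notin S -> i + n <= d -> v \notin map s (iota i n.+1).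
  move=> vS h; apply: contra vS => /mapP[k]; rewrite mem_iota => hk ->.
  by apply: s_in; lia.
have no_two v i j : v \notin S -> i < j <= d -> e v (s i) -> e v (s j) -> False.
  move=> vS ij evi evj; have [|h1 h2] := spath i (j - i); first by lia.
  apply: (acyc (v :: map s (iota i (j - i).+1))).
    by rewrite /= size_map size_iota; lia.
  rewrite /ucycle /= rcons_path h1 h2 evi subnKC; last by lia.
  rewrite symE evj /=; have h : i + (j - i) <= d by lia.
  by have := snotin v _ _ vS h; have := suniq _ _ h => /= -> ->.
(* The cycle is [w], [v], [s i], ..., [s j]; it is a triangle when [i = j]. *)
have no_pp v w i j : v \notin S -> w \notin S -> i <= j <= d ->
    e v w -> e v (s i) -> e w (s j) -> False.
  move=> vS wS ij evw evi ewj; have [|h1 h2] := spath i (j - i); first by lia.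
  apply: (acyc (w :: v :: map s (iota i (j - i).+1))).
    by rewrite /= size_map size_iota; lia.
  rewrite /ucycle /= rcons_path h1 h2 evi subnKC; last by lia.
  rewrite symE evw symE ewj /= inE negb_or.
  have h : i + (j - i) <= d by lia.
  have := snotin v _ _ vS h; have := snotin w _ _ wS h.
  have := suniq _ _ h => /= -> -> ->; rewrite !andbT.
  by apply: contraTneq evw => ->; rewrite irrE.
have hostP v : v \notin S -> pos v <= d /\ e v (s (pos v)).
  move=> vS; have hS : has (e v) S.
    by case: (pdom v) => [vp|[w wS evw]]; [rewrite /S vp in vS | apply/hasP; exists w].
  rewrite /pos (negbTE vS); split; last exact: nth_find.
  by move: hS; rewrite has_find sizeS.
have host_uniq v j : v \notin S -> j <= d -> e v (s j) -> j = pos v.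
  move=> vS jd evj; have [hd eh] := hostP _ vS.
  by case: (ltngtP j (pos v)) => // h;
    [case: (@no_two v j (pos v)) | case: (@no_two v (pos v) j)];
    rewrite ?h ?hd.
have posK v : v \in S -> pos v <= d /\ s (pos v) = v.
  by move=> vS; rewrite /pos vS -ltnS -sizeS index_mem vS /s nth_index.
have sK i : i <= d -> pos (s i) = i.
  by move=> id; rewrite /pos s_in // index_uniq ?sizeS.
have dV : d < #|V|.
  by have := max_card (mem S); rewrite (card_uniqP pU) sizeS.
(* The distance is at most the diameter [d], and [d < #|V|], so it is not the default value. *)
have far v j : v \notin S -> j <= d -> exists2 k, k <= d & walk e k v (s j).
  move=> vS jd; exists (dist e v (s j)); first exact: dist_le_diam.
  by apply: dist_walk; apply: leq_ltn_trans dV; apply: dist_le_diam.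
(* The first step from [v] must lead to its host: another spine vertex contradicts [host_uniq], and
   a vertex off the spine contradicts [no_pp]. *)
have first_step v k j : v \notin S -> j <= d -> walk e k v (s j) ->
    0 < k /\ walk e k.-1 (s (pos v)) (s j).
  move=> vS jd [[|a q] [/= aqP lq <-]].
    by rewrite lq s_in in vS.
  case/andP: aqP => eva qP; suff [ad sa] : pos v <= d /\ a = s (pos v).
    by rewrite sa in qP lq; split=> //; exists q.
  have [hv ev] := hostP _ vS.
  case: (boolP (a \in S)) => [/posK[ad sa]|aS].
    by rewrite -(host_uniq v (pos a)) ?sa.
  have [ha ea] := hostP _ aS; case: (leqP (pos v) (pos a)) => h.
    by case: (@no_pp v a (pos v) (pos a)); rewrite ?h.
  by case: (@no_pp a v (pos a) (pos v)); rewrite ?(ltnW h) // symE.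
exists s, pos, (fun v => v \in S); split.
- by move=> i id; rewrite s_in ?sK.
- exact: posK.
- move=> v vS; have [hd ev] := hostP _ vS.
  (* A pendant at one end has a walk of length at most [d] to the other end; without its first step
     this joins the two ends in fewer than [d] steps. *)
  apply/andP; split.
    rewrite lt0n; apply/eqP => p0; have [//|k kd wk] := far v d vS.
    by have [//|k0] := first_step _ _ _ vS _ wk; rewrite p0 => /d_le; lia.
  rewrite ltn_neqAle hd andbT; apply/eqP => p0; have [//|k kd wk] := far v 0 vS.
  by have [//|k0] := first_step _ _ _ vS _ wk; rewrite p0 => /(walk_sym symE) /d_le; lia.
- move=> v w; case: (boolP (v \in S)) => vS; case: (boolP (w \in S)) => wS /=.
  + have [vd sv] := posK _ vS; have [wd sw] := posK _ wS.
    apply/idP/idP.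
      case: (ltngtP (pos v) (pos w)) => h evw.
      * by rewrite (chord (pos v) (pos w)) ?eqxx ?orbT ?h ?sv ?sw.
      * by rewrite (chord (pos w) (pos v)) ?eqxx ?h ?sv ?sw // symE.
      * by suff vw : v = w by [rewrite vw irrE in evw]; rewrite -sv h sw.
    by rewrite -{3}sv -{3}sw => /orP[]/eqP h; rewrite h; [rewrite symE|]; apply: sadj; lia.
  + have [vd sv] := posK _ vS; have [wd ew] := hostP _ wS.
    apply/idP/eqP => [evw|h]; last by rewrite -sv h symE.
    by apply: host_uniq; rewrite ?sv // symE.
  + have [vd ev] := hostP _ vS; have [wd sw] := posK _ wS.
    apply/idP/eqP => [evw|h]; last by rewrite -sw -h.
    by apply/esym/host_uniq; rewrite ?sw.
  + apply/negbTE/negP => evw; have [vd ev] := hostP _ vS; have [wd ew] := hostP _ wS.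
    case: (leqP (pos v) (pos w)) => h.
      by case: (@no_pp v w (pos v) (pos w)); rewrite ?h.
    by case: (@no_pp w v (pos w) (pos v)); rewrite ?(ltnW h) // symE.
Qed.

Definition between (i j k : nat) : bool := (i < j < k) || (k < j < i).

Lemma betweenC i j k : between i j k = between k j i.
Proof. exact: orbC. Qed.

Lemma between_trans i j k l : between i k j -> between k l i -> between i l j.
Proof. by rewrite /between; lia. Qed.

(** Of three distinct positions one is in the middle; here it must be [k], which cuts the interval
    containing [l] in two. *)
Lemma between_split i j k l : k != i -> k != j -> l != k -> ~~ between k j i ->
  ~~ between k i j -> between i l j -> between k l i || between k l j.
Proof. by rewrite /between; lia. Qed.

(** * Distances and branch vertices in coordinates *)

Section Comb.
Variables (V : finType) (e : rel V) (d : nat) (s : nat -> V).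
Variables (pos : V -> nat) (sp : pred V).
Hypothesis coordP : spine_coordinates e d s pos sp.

Lemma sp_s i : i <= d -> sp (s i).
Proof. by case/(spineK coordP). Qed.

Lemma pos_s i : i <= d -> pos (s i) = i.
Proof. by case/(spineK coordP). Qed.

Lemma s_pos v : sp v -> s (pos v) = v.
Proof. by case/(spine_posK coordP). Qed.

Lemma pos_le v : pos v <= d.
Proof.
case: (boolP (sp v)) => [/(spine_posK coordP)[]//|/(pendant_pos coordP)].
by case/andP=> _ /ltnW.
Qed.

Lemma spine_inj v w : sp v -> sp w -> pos v = pos w -> v = w.
Proof. by move=> /s_pos {2}<- /s_pos {2}<- ->. Qed.

Lemma adj_symmetric : symmetric e.
Proof.
by move=> x y; rewrite !(adjE coordP) andbC addbC orbC [pos y == pos x]eq_sym.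
Qed.

(** The absolute difference: one of the truncated subtractions is 0. *)
Definition gap (i j : nat) : nat := (i - j) + (j - i).

Lemma walk_spine i j : i <= d -> j <= d -> walk e (gap i j) (s i) (s j).
Proof.
suff H n k : k + n <= d -> walk e n (s k) (s (k + n)).
  move=> id jd; case: (leqP i j) => ij.
    have := @H (j - i) i; rewrite /gap subnKC // (eqP ij) add0n; exact.
  have := @H (i - j) j; rewrite /gap subnKC ?(ltnW ij) // (eqP (ltnW ij)) addn0.
  by move=> /(_ id); apply: walk_sym adj_symmetric.
elim: n => [|n IHn]; first by rewrite addn0 => _; apply: walk0.
rewrite addnS => h; rewrite -addn1; apply: walk_trans (IHn (ltnW h)) (walk1 _).
by rewrite (adjE coordP) !sp_s ?(ltnW h) //= !pos_s ?(ltnW h) // eqxx orbT.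
Qed.

Lemma walk_to_spine v : walk e (~~ sp v) v (s (pos v)).
Proof.
case: (boolP (sp v)) => spv; first by rewrite s_pos //; apply: walk0.
apply: walk1; rewrite (adjE coordP) (negbTE spv) /= sp_s ?pos_le //.
by rewrite pos_s ?pos_le // eqxx.
Qed.

Lemma dist_le_gap v w : dist e v w <= gap (pos v) (pos w) + ~~ sp v + ~~ sp w.
Proof.
rewrite [_ + ~~ sp v]addnC -addnA; apply: dist_le_walk.
apply: walk_trans (walk_to_spine v) _.
apply: walk_trans (walk_spine (pos_le v) (pos_le w)) _.
exact: walk_sym adj_symmetric (walk_to_spine w).
Qed.

(** Hosts are interior to the spine, so a pendant vertex is no farther away than an end of the
    spine. *)
Lemma ecc_le v : ecc e v <= maxn (pos v) (d - pos v) + ~~ sp v.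
Proof.
apply/bigmax_leqP => w _; case: (eqVneq v w) => [->|_].
  by apply: leq_trans (dist_le_walk (walk0 e w)) _.
apply: leq_trans (dist_le_gap v w) _.
have := pos_le w; have := @pendant_pos _ _ _ _ _ _ coordP w; rewrite /gap.
by case: (sp w) (sp v) => [] [] => //= h wd; try have := h isT; lia.
Qed.

Definition pendants (i : nat) : {set V} := [set w | ~~ sp w & pos w == i].

Lemma pendants_pos i : pendants i != set0 -> 0 < i < d.
Proof.
by case/set0Pn=> w; rewrite inE => /andP[/(pendant_pos coordP) h /eqP<-].
Qed.

(** A pendant vertex is adjacent only to its host, and a spine vertex has at most two neighbours on
    the spine. Conversely, a host is interior to the spine, so a pendant is its third neighbour. *)
Lemma branchE v : (v \in branches (whole e)) = sp v && (pendants (pos v) != set0).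
Proof.
rewrite inE in_setT /= /degree.
have nE u : (u \in nbrs (whole e) v) = e v u by rewrite inE in_setT.
apply/idP/andP => [deg3|[spv /set0Pn[w]]].
  have spv : sp v.
    apply: contraTT deg3 => spv; rewrite -ltnNge.
    apply: (@leq_ltn_trans 1) => //; rewrite -(cards1 (s (pos v))).
    apply/subset_leq_card/subsetP => u; rewrite nE !inE (adjE coordP) (negbTE spv) /=.
    by case/andP=> spu /eqP->; rewrite s_pos.
  split=> //; apply: contraTneq deg3 => p0; rewrite -ltnNge ltnS.
  apply: (@leq_trans #|[set s (pos v).-1; s (pos v).+1]|); last first.
    by rewrite cards2; case: (_ != _).
  apply/subset_leq_card/subsetP => u; rewrite nE !inE (adjE coordP) spv /=.
  case: (boolP (sp u)) => /= spu.
    by case/orP=> /eqP h; rewrite -(s_pos spu) h ?eqxx ?orbT.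
  by move=> /eqP h; have := in_set0 u; rewrite -p0 inE spu h eqxx.
rewrite inE => /andP[spw /eqP pw].
have := pendant_pos coordP spw; rewrite pw => /andP[v0 vd].
have sp1 : sp (s (pos v).-1) by apply: sp_s; lia.
have sp2 : sp (s (pos v).+1) by apply: sp_s.
have p1 : pos (s (pos v).-1) = (pos v).-1 by apply: pos_s; lia.
have p2 : pos (s (pos v).+1) = (pos v).+1 by apply: pos_s.
apply: (@leq_trans #|[set w; s (pos v).-1; s (pos v).+1]|).
  rewrite setUC cardsU1 !inE cards2 negb_or.
  have -> : s (pos v).+1 != w by apply: contraNneq spw => <-.
  have -> : w != s (pos v).-1 by apply: contraNneq spw => ->.
  suff -> : s (pos v).+1 != s (pos v).-1 by [].
  by apply/eqP => /(congr1 pos); rewrite p1 p2; lia.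
apply/subset_leq_card/subsetP => u; rewrite nE !inE (adjE coordP) spv /=.
case/orP=> [/orP[]|] /eqP->; rewrite ?(negbTE spw) ?sp1 ?sp2 ?pw ?p1 ?p2 /= ?eqxx ?orbT //.
by rewrite prednK // eqxx.
Qed.

(** * The branch-leaf representation in coordinates *)

(* A stage of the suppression process: only spine vertices [D] of degree 2
   have been deleted, and spine vertices are adjacent when everything between
   them has been deleted. *)
Record bl_stage (D : {set V}) (G : Defs.fgraph V) : Prop := BlStage {
  stage_vset : vset G = ~: D;
  stage_del : forall v, v \in D -> [/\ sp v, 0 < pos v < d & pendants (pos v) = set0];
  stage_adj : forall x y, adj G x y <-> [/\ x \notin D, y \notin D &
    if sp x && sp y then pos x <> pos y /\ forall z, sp z ->
      between (pos x) (pos z) (pos y) -> z \in D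
    else e x y] }.

Lemma stage_whole : bl_stage set0 (whole e).
Proof.
split=> [|v|x y]; first by rewrite setC0.
  by rewrite inE.
rewrite !inE /=; case: ifP => [/andP[spx spy]|_]; last by split=> // -[].
rewrite (adjE coordP) spx spy /=; split=> [h|[_ _ [xy h]]].
  by split=> //; split=> [|z spz]; rewrite /between; lia.
have := pos_le x; have := pos_le y => yd xd.
have noD k : k <= d -> ~~ between (pos x) k (pos y).
  by move=> kd; apply/negP; rewrite -{1}(pos_s kd) => /(h _ (sp_s kd)); rewrite inE.
case: (ltngtP (pos x) (pos y)) => // xy'.
  by have := noD (pos x).+1; rewrite /between; lia.
by have := noD (pos y).+1; rewrite /between; lia.
Qed.

Section Stage.
Variables (D : {set V}) (G : Defs.fgraph V).
Hypothesis stageP : bl_stage D G.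

Lemma stage_nbrs x y : (y \in nbrs G x) = adj G x y.
Proof.
rewrite inE (stage_vset stageP) inE; apply: andb_idl.
by case/(stage_adj stageP).
Qed.

(** The end [s d] is never deleted, so there is a nearest surviving spine vertex to the right. *)
Lemma stage_right v : sp v -> v \notin D -> pos v < d ->
  exists w, [/\ sp w, pos v < pos w & w \in nbrs G v].
Proof.
move=> spv vD vd; pose P k := [&& pos v < k, k <= d & s k \notin D].
have exP : exists k, P k.
  exists d; rewrite /P vd leqnn; apply/negP => /(stage_del stageP)[_].
  by rewrite pos_s // ltnn andbF.
case: (ex_minnP exP) => k /and3P[vk kd skD] kmin.
exists (s k); rewrite sp_s // pos_s // stage_nbrs; split=> //.
apply/(stage_adj stageP); split=> //; rewrite spv sp_s //= pos_s //.
split=> [|z spz]; rewrite /between; [lia|move=> h].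
apply/negPn/negP => zD; have := kmin (pos z); rewrite /P pos_le s_pos // zD.
by lia.
Qed.

Lemma stage_left v : sp v -> v \notin D -> 0 < pos v ->
  exists w, [/\ sp w, pos w < pos v & w \in nbrs G v].
Proof.
move=> spv vD v0; pose P k := (k < pos v) && (s k \notin D).
have exP : exists k, P k.
  exists 0; rewrite /P v0; apply/negP => /(stage_del stageP)[_].
  by rewrite pos_s.
have ubP k : P k -> k <= d by case/andP=> kv _; have := pos_le v; lia.
case: (ex_maxnP exP ubP) => k Pk kmax; have kd := ubP k Pk.
case/andP: Pk => kv skD.
exists (s k); rewrite sp_s // pos_s // stage_nbrs; split=> //.
apply/(stage_adj stageP); split=> //; rewrite spv sp_s //= pos_s //.
split=> [|z spz]; rewrite /between; [lia|move=> h].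
apply/negPn/negP => zD; have := kmax (pos z); rewrite /P s_pos // zD.
by lia.
Qed.

(** Of two spine neighbours on the same side, the nearer would lie between [v] and the farther, and
    so would have been deleted. *)
Lemma stage_nbr_uniq v w w' : sp v -> sp w -> sp w' ->
  w \in nbrs G v -> w' \in nbrs G v -> (pos v < pos w) = (pos v < pos w') -> w = w'.
Proof.
rewrite !stage_nbrs => spv spw spw'.
case/(stage_adj stageP) => vD wD; rewrite spv spw /= => -[vw hw].
case/(stage_adj stageP) => _ wD'; rewrite spv spw' /= => -[vw' hw'] side.
have {}hw := contraNN (hw _ spw') wD'; have {}hw' := contraNN (hw' _ spw) wD.
by apply: spine_inj => //; move: side hw hw'; rewrite /between; lia.
Qed.

Lemma stage_pendant v w : v \notin D -> sp v -> ~~ sp w -> pos w = pos v -> w \in nbrs G v.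
Proof.
move=> vD spv spw pw; rewrite stage_nbrs; apply/(stage_adj stageP).
rewrite (adjE coordP) spv (negbTE spw) pw /= eqxx; split=> //.
by apply: contra spw => /(stage_del stageP)[].
Qed.

(** Pendant vertices and the ends of the spine have degree at most 1; a host keeps a neighbour on
    each side besides its pendants, hence has degree at least 3. *)
Lemma stage_trunk v : v \in trunks G ->
  [/\ v \notin D, sp v, 0 < pos v < d & pendants (pos v) = set0].
Proof.
rewrite inE (stage_vset stageP) inE => /andP[vD /eqP deg2].
have spv : sp v.
  apply/negPn/negP => spv; suff: degree G v <= 1 by rewrite deg2.
  apply/card_le1_eqP => x y; rewrite !stage_nbrs.
  case/(stage_adj stageP) => _ _ + /(stage_adj stageP)[_ _].
  rewrite (negbTE spv) /= !(adjE coordP) (negbTE spv) /=.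
  by move=> /andP[spx /eqP px] /andP[spy /eqP py]; apply: spine_inj; rewrite // -px.
split=> //.
- have side P : (forall x, x \in nbrs G v -> sp x /\ (pos v < pos x) = P) -> False.
    move=> H; suff: degree G v <= 1 by rewrite deg2.
    apply/card_le1_eqP => x y xv yv; have [spx px] := H x xv; have [spy py] := H y yv.
    by apply: (stage_nbr_uniq spv); rewrite ?px ?py.
  have nsp x : x \in nbrs G v -> ~~ (0 < pos v < d) -> sp x /\ pos v <> pos x.
    rewrite stage_nbrs => /(stage_adj stageP)[_ _]; rewrite spv /=.
    case: (boolP (sp x)) => [spx [] //|spx].
    rewrite (adjE coordP) spv (negbTE spx) /= => /eqP ->.
    by rewrite (pendant_pos coordP spx).
  apply/negPn/negP => h; have [v0|v0] := posnP (pos v).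
    apply: (side true) => x /nsp /(_ h)[spx]; split=> //; lia.
  by apply: (side false) => x /nsp /(_ h)[spx]; split=> //; have := pos_le x; lia.
- apply/eqP/set0Pn => -[w]; rewrite inE => /andP[spw /eqP pw].
  have := pendant_pos coordP spw; rewrite pw => /andP[v0 vd].
  have [a [spa pa na]] := stage_left spv vD v0.
  have [b [spb pb nb]] := stage_right spv vD vd.
  have nw := stage_pendant vD spv spw pw.
  suff : #|[set w; a; b]| <= degree G v.
    rewrite deg2 setUC cardsU1 !inE cards2 negb_or.
    have -> : b != w by apply: contraNneq spw => <-.
    have -> : w != a by apply: contraNneq spw => ->.
    suff -> : b != a by [].
    by apply: contraTneq pa => <-; lia.
  by apply/subset_leq_card/subsetP => u /setUP[/setUP[]|] /set1P->.
Qed.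

Lemma stage_suppress v : v \in trunks G -> bl_stage (v |: D) (suppress G v).
Proof.
move=> vG; have [vD spv vd pv] := stage_trunk vG; split=> /=.
- by rewrite (stage_vset stageP); apply/setP=> x; rewrite !inE negb_or.
- move=> x; rewrite !inE => /predU1P[->|] //; exact: (stage_del stageP).
move=> x y; rewrite (stage_vset stageP) !stage_nbrs !inE !negb_or.
have spN z : adj G v z -> sp z.
  move=> vz; apply/negPn/negP => spz; have := in_set0 z; rewrite -pv inE spz /=.
  case/(stage_adj stageP): vz => _ _.
  by rewrite spv (negbTE spz) (adjE coordP) spv (negbTE spz) /= eq_sym => ->.
split.
  case/and3P=> /andP[xv xD] /andP[yv yD] adj_xy; split; rewrite ?xv ?yv //.
  case/orP: adj_xy => [/(stage_adj stageP)[_ _]|/and3P[xy vx vy]].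
    by case: ifP => // _ [pxy h]; split=> // z spz /(h z spz) zD; rewrite !inE zD orbT.
  have [spx spy] := (spN x vx, spN y vy); rewrite spx spy /=.
  have [_ _] := (stage_adj stageP _ _).1 vx; rewrite spv spx /= => -[pvx hx].
  have [_ _] := (stage_adj stageP _ _).1 vy; rewrite spv spy /= => -[pvy hy].
  split=> [pxy|z spz pz]; first by rewrite (spine_inj spx spy pxy) eqxx in xy.
  (* As [x] and [y] survive, neither separates [v] from the other, so [v] lies between them. *)
  have hxy := contraNN (hx _ spy) yD; have hyx := contraNN (hy _ spx) xD.
  rewrite !inE; case: (eqVneq z v) => //= zv.
  have pzv : pos z != pos v by apply: contraNneq zv => /(spine_inj spz spv)->.
  have /orP[/(hx z spz)//|/(hy z spz)//] :
    between (pos v) (pos z) (pos x) || between (pos v) (pos z) (pos y).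
  by apply: between_split pz => //; apply/eqP.
case=> /andP[xv xD] /andP[yv yD] adj_xy; rewrite xv xD yv yD /=.
case: ifP adj_xy => [/andP[spx spy] [pxy h]|spxy exy]; last first.
  by apply/orP; left; apply/(stage_adj stageP); rewrite spxy.
have neq_pos z : sp z -> z != v -> pos v <> pos z.
  by move=> spz zv /(spine_inj spv spz)/esym/eqP; rewrite (negbTE zv).
have hD z : sp z -> pos v != pos z -> between (pos x) (pos z) (pos y) -> z \in D.
  move=> spz vz /(h z spz); rewrite !inE => /predU1P[zv|//].
  by rewrite zv eqxx in vz.
have far_v z l : between (pos v) (pos z) l -> pos v != pos z.
  by rewrite /between; lia.
(* If [v] lies between [x] and [y], both are neighbours of [v] and get joined; otherwise all
   vertices between them were already in [D]. *)
case: (boolP (between (pos x) (pos v) (pos y))) => btw.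
  apply/orP; right; apply/and3P; split; first by apply: contra_not_neq pxy => ->.
    apply/(stage_adj stageP); split=> //; rewrite spv spx; split=> [|z spz hz].
      exact: neq_pos.
    exact: hD (far_v _ _ hz) (between_trans btw hz).
  apply/(stage_adj stageP); split=> //; rewrite spv spy; split=> [|z spz hz].
    exact: neq_pos.
  apply: hD (far_v _ _ hz) _ => //; rewrite betweenC.
  by apply: between_trans hz; rewrite betweenC.
apply/orP; left; apply/(stage_adj stageP); split=> //; rewrite spx spy; split=> // z spz hz.
by apply: (hD z spz) => //; apply: contraNneq btw => ->.
Qed.

End Stage.

Lemma stage_branch_leaf_rep : exists D, bl_stage D (branch_leaf_rep e).
Proof.
rewrite /branch_leaf_rep; elim: #|V| => [|k [D IHk]].
  by exists set0; apply: stage_whole.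
rewrite iterS /suppress_step; case: pickP => [v vH|_]; last by exists D.
by exists (v |: D); apply: stage_suppress.
Qed.

(** Branch vertices are never deleted, so a spine neighbour of [b] in the representation is not
    beyond [b1] or [b2]. It is thus interior to the spine, has neighbours on both sides and is not a
    leaf; only [w] can be one. *)
Lemma branch_in_sparse b w b1 b2 : b \in branches (whole e) ->
  pendants (pos b) = [set w] -> b1 \in branches (whole e) ->
  b2 \in branches (whole e) -> pos b1 < pos b < pos b2 -> b \in sparse_branches e.
Proof.
have [D stageP] := stage_branch_leaf_rep.
move=> bB pw; rewrite !branchE => /andP[sp1 p1] /andP[sp2 p2] btw.
rewrite inE bB /= -(cards1 w); apply/subset_leq_card/subsetP => y.
case/setIP=> yb /setIdP[]; rewrite (stage_vset stageP) in_setC => yD /eqP deg1.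
move: bB yb; rewrite branchE => /andP[spb _]; rewrite (stage_nbrs stageP).
case/(stage_adj stageP)=> bD _; rewrite spb; case: (boolP (sp y)) => spy /=; last first.
  by rewrite (adjE coordP) spb (negbTE spy) -pw inE spy /= eq_sym.
case=> pby hby; have keep c : sp c -> pendants (pos c) != set0 ->
    ~~ between (pos b) (pos c) (pos y).
  move=> spc pc; apply/negP => /(hby c spc) /(stage_del stageP)[_ _ pc0].
  by rewrite pc0 eqxx in pc.
have k1 := keep _ sp1 p1; have k2 := keep _ sp2 p2.
have yd : 0 < pos y < d.
  by move: k1 k2 (pendants_pos p1) (pendants_pos p2); rewrite /between; lia.
have /andP[y0 yd'] := yd.
have [a [spa pa na]] := stage_left stageP spy yD y0.
have [c [spc pc nc]] := stage_right stageP spy yD yd'.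
have /card_le1_eqP/(_ a c na nc) ac : degree (branch_leaf_rep e) y <= 1 by rewrite deg1.
by rewrite ac ltnNge ltnW in pc.
Qed.

End Comb.

(** * Charging the cost of a broadcast to vertices *)

Section Counting.
Variables (V : finType) (e : rel V) (d : nat) (s : nat -> V).
Variables (pos : V -> nat) (sp : pred V).
Hypothesis coordP : spine_coordinates e d s pos sp.
Variable f : bfun e.
Hypotheses (fB : broadcast f) (fI : boundary_independent f).

Let B := branches (whole e).
Let R := sparse_branches e.
Local Notation pendants := (pendants pos sp).

(** The length of the walk from [v] to [s i] through the host of [v], an upper bound for their
    distance. *)
Definition reach (v : V) (i : nat) : nat := gap (pos v) i + ~~ sp v.

(** [s i] hears [v] and is off its boundary, so boundary independence lets it hear no other
    vertex. *)
Lemma spine_heard_once v w i : i <= d -> 0 < f v -> 0 < f w ->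
  reach v i < f v -> reach w i <= f w -> v = w.
Proof.
move=> id fv fw iv iw.
have le_reach u : dist e (s i) u <= reach u i.
  have := dist_le_gap coordP (s i) u; rewrite (sp_s coordP) // (pos_s coordP) //.
  by rewrite addn0 /reach /gap [i - _ + _]addnC.
have hv : dist e (s i) v < f v by apply: leq_ltn_trans iv.
have : s i \in private_nbhd f v.
  have fvb : v \in broadcasting f by rewrite inE.
  have /subsetP := forall_inP fI v fvb; apply.
  by rewrite !inE /hears fvb (ltnW hv) (ltn_eqF hv).
rewrite inE => /andP[_ /forallP/(_ w)/implyP].
rewrite /hears inE fw (leq_trans (le_reach w) iw) => /(_ isT)/eqP //.
Qed.

Lemma f_le v : f v <= maxn (pos v) (d - pos v) + ~~ sp v.
Proof. exact: leq_trans (forallP fB v) (ecc_le coordP v). Qed.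

(** With [f v = 2] the only index at reach below [f v] is that of the host, a branch vertex, whose
    sole substitute is [v]. *)
Definition lonely (v : V) : bool :=
  [&& ~~ sp v, f v == 2 :> nat & #|pendants (pos v)| == 1].

(* The second vertex given to a lonely broadcaster with host [s i] is the host
   itself if it lies in [R], and otherwise the next spine vertex on a side
   without branch vertices. *)
Definition spare (i : nat) : nat :=
  if s i \in R then i else if [forall b in B, i <= pos b] then i.-1 else i.+1.

Lemma host_branch v : ~~ sp v -> s (pos v) \in B.
Proof.
move=> spv; have vd := pos_le coordP v.
rewrite (branchE coordP) (sp_s coordP) // (pos_s coordP) //.
by apply/set0Pn; exists v; rewrite inE spv /=.
Qed.

(** With branch vertices on both sides, a host with a single pendant is in [R] by
    [branch_in_sparse]. *)
Lemma spareP v : lonely v ->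
  [\/ spare (pos v) = pos v /\ s (pos v) \in R,
      spare (pos v) = (pos v).-1 /\ forall b, b \in B -> pos v <= pos b |
      spare (pos v) = (pos v).+1 /\ forall b, b \in B -> pos b <= pos v].
Proof.
case/and3P=> spv _ /cards1P[w pw]; rewrite /spare.
case: ifP => [|/negbT sR]; first by constructor 1.
have vd := pos_le coordP v; have hB := host_branch spv.
case: (boolP [forall b in B, _]) => [/forall_inP|]; first by constructor 2.
case/forall_inPn=> b1 b1B; rewrite -ltnNge => lt1; constructor 3; split=> // b2 b2B.
rewrite leqNgt; apply: contra sR => lt2; have psv := pos_s coordP vd.
by apply: (branch_in_sparse coordP hB _ b1B b2B); rewrite psv ?lt1 // pw.
Qed.

Lemma spare_le v : lonely v -> spare (pos v) <= d.
Proof.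
move=> lv; have /and3P[spv _ _] := lv; have := pendant_pos coordP spv.
by case: (spareP lv) => -[-> _]; lia.
Qed.

(** The vertices charged to [v]. As [pos t] is the index of the host when [t] is pendant, the first
    clause replaces branch vertices by their pendants. The factor [0 < f v] keeps silent pendants
    from claiming themselves. *)
Definition own (v : V) : {set V} :=
  [set t | (0 < f v) && [|| (t \notin B) && (reach v (pos t) < f v),
                            (t == v) && ~~ sp v
                          | lonely v && (t == s (spare (pos v)))]].

Definition counted : {set V} :=
  [set b in R | [exists v, lonely v && (pos v == pos b)]].

Lemma sparse_branch b : b \in R -> b \in B.
Proof. by rewrite inE => /andP[]. Qed.

Lemma branch_sp b : b \in B -> sp b.
Proof. by rewrite (branchE coordP) => /andP[]. Qed.

Lemma lonely_gt0 v : lonely v -> 0 < f v.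
Proof. by case/and3P=> _ /eqP->. Qed.

Lemma own_sub v : own v \subset ~: B :|: counted.
Proof.
apply/subsetP => t; rewrite [_ \in own v]inE in_setU in_setC => /andP[_].
case/or3P=> [/andP[tB _]|/andP[/eqP-> spv]|/andP[lv /eqP->]].
- by rewrite tB.
- by apply/orP; left; apply: contra spv => /branch_sp.
have /and3P[spv _ _] := lv; have := pendant_pos coordP spv => vd.
case: (spareP lv) => -[-> h]; apply/orP.
- right; rewrite [_ \in counted]inE h; apply/existsP; exists v.
  by rewrite lv (pos_s coordP (pos_le coordP v)) eqxx.
- by left; apply/negP => /h; rewrite (pos_s coordP); lia.
- by left; apply/negP => /h; rewrite (pos_s coordP); lia.
Qed.

Lemma own_disjoint v w : v != w -> [disjoint own v & own w].
Proof.
move=> vw; apply/pred0P => t /=; apply/negbTE/negP.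
suff H : forall x y, x != y -> 0 < f x -> 0 < f y ->
    [|| (t \notin B) && (reach x (pos t) < f x),
        (t == x) && ~~ sp x | lonely x && (t == s (spare (pos x)))] ->
    [|| (t \notin B) && (reach y (pos t) < f y),
        (t == y) && ~~ sp y | lonely y && (t == s (spare (pos y)))] -> False.
  by rewrite ![_ \in own _]inE => /andP[/andP[fv tv] /andP[fw tw]]; apply: (H v w).
have td := pos_le coordP t.
have two x : lonely x -> [/\ f x = 2 :> nat, ~~ sp x & 0 < pos x < d].
  by case/and3P=> spx /eqP fx _; rewrite (pendant_pos coordP).
(* Shared vertices are excluded by a spine vertex strictly inside the range of one broadcaster and
   within that of the other. Below, [KP] and [KS] set the first clause of [own] against the second
   and third, [PS] the second against the third. *)
have excl x y i : x != y -> 0 < f x -> 0 < f y -> i <= d ->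
    reach x i < f x -> reach y i <= f y -> False.
  by move=> + fx fy id ix iy => /eqP[]; apply: spine_heard_once iy.
have KP x y : x != y -> 0 < f x -> 0 < f y ->
    t \notin B -> reach x (pos t) < f x -> (t == y) && ~~ sp y -> False.
  move=> xy fx fy _ tx /andP[/eqP ty spy]; apply: (excl _ _ _ xy fx fy td tx).
  by rewrite ty /reach spy /gap subnn.
have KS x y : x != y -> 0 < f x -> 0 < f y ->
    t \notin B -> reach x (pos t) < f x -> lonely y && (t == s (spare (pos y))) -> False.
  move=> xy fx fy tB tx /andP[ly /eqP ty].
  apply: (excl _ _ _ xy fx fy td tx); have [fy2 spy yd] := two _ ly.
  (* The spare is the host or next to it, hence at reach at most 2. *)
  rewrite fy2 ty (pos_s coordP) ?spare_le // /reach spy /gap.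
  by case: (spareP ly) => -[-> _]; lia.
have PS x y : (t == x) && ~~ sp x -> lonely y && (t == s (spare (pos y))) -> False.
  move=> /andP[/eqP<- spt] /andP[ly /eqP ty].
  by rewrite ty (sp_s coordP) ?spare_le in spt.
move=> x y xy fx fy; have yx : y != x by rewrite eq_sym.
case/or3P=> [/andP[tB tx]|tx|tx] /or3P[/andP[tB' ty]|ty|ty].
- by apply: (excl _ _ _ xy fx fy td tx (ltnW ty)).
- exact: (KP _ _ xy fx fy tB tx ty).
- exact: (KS _ _ xy fx fy tB tx ty).
- exact: (KP _ _ yx fy fx tB' ty tx).
- by case/andP: tx xy => /eqP<- _; case/andP: ty => /eqP<- _; rewrite eqxx.
- exact: (PS _ _ tx ty).
- exact: (KS _ _ yx fy fx tB' ty tx).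
- exact: (PS _ _ ty tx).
case/andP: tx ty => lx /eqP-> /andP[ly /eqP/(congr1 pos)].
rewrite !(pos_s coordP) ?spare_le // => eq_spare.
have [fx2 spx xd] := two _ lx; have [fy2 spy yd] := two _ ly.
have xle := pos_le coordP x; have yle := pos_le coordP y.
(* A common host would be at reach 1 from both, while both values are 2. *)
have pxy : pos x <> pos y.
  move=> pxy; apply: (excl x y (pos x)) => //; rewrite ?fx2 ?fy2 /reach /gap -?pxy subnn.
    by case: (sp x).
  by case: (sp y).
(* A spare that differs from its host points away from all other hosts, so distinct hosts have
   distinct spares. *)
have side z z' : lonely z -> ~~ sp z' -> [\/ spare (pos z) = pos z,
    spare (pos z) = (pos z).-1 /\ pos z <= pos z' |
    spare (pos z) = (pos z).+1 /\ pos z' <= pos z].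
  move=> lz /host_branch hz'; have ps := pos_s coordP (pos_le coordP z').
  case: (spareP lz) => -[-> h]; [by constructor 1 | constructor 2 | constructor 3].
    by have := h _ hz'; rewrite ps.
  by have := h _ hz'; rewrite ps.
by case: (side x y lx spy) => [|[]|[]]; case: (side y x ly spx) => [|[]|[]]; lia.
Qed.

(** Each index of the window is the position of a vertex outside [B], namely [s i] or one of its
    pendants; different positions give different vertices. *)
Lemma size_own n a v : (forall k, k < n -> a + k <= d /\ reach v (a + k) < f v) ->
  n <= #|own v|.
Proof.
move=> H; rewrite -(size_iota a n) cardE -(size_map pos).
apply: uniq_leq_size; first exact: iota_uniq.
move=> i; rewrite mem_iota => ai; have [|] := H (i - a); first by lia.
rewrite subnKC; last by lia.
move=> id ri; apply/mapP.
suff [t tB ti] : exists2 t, t \notin B & pos t = i.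
  exists t; last by [].
  by rewrite mem_enum inE tB ti ri (leq_ltn_trans _ ri).
case: (boolP (s i \in B)) => siB; last by exists (s i); rewrite ?(pos_s coordP).
move: siB; rewrite (branchE coordP) (pos_s coordP) // => /andP[_ /set0Pn[t]].
rewrite inE => /andP[spt /eqP pt]; exists t => //.
by apply: contra spt => /branch_sp.
Qed.

Lemma card_own v : f v <= #|own v|.
Proof.
have [-> //|fv] := posnP (f v).
have := f_le v; have := pos_le coordP v; rewrite /maxn.
case: (boolP (sp v)) => [spv vd fle|spv _ fle].
  have reachE i : reach v i = gap (pos v) i by rewrite /reach spv addn0.
  (* The window extends from [pos v] to the right if it fits; otherwise the eccentricity bound gives
     [f v <= pos v], and it extends to the left. *)
  case: (leqP (pos v + f v) d) => h.
    apply: (@size_own _ (pos v)) => k kf; rewrite reachE /gap; lia.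
  apply: (@size_own _ ((pos v).+1 - f v)) => k kf; rewrite reachE /gap.
  by move: fle; case: ltnP; lia.
have vd := pendant_pos coordP spv.
have reachE i : reach v i = (gap (pos v) i).+1 by rewrite /reach spv addn1.
have v_own : v \in own v by rewrite inE fv eqxx spv /= orbT.
case: (ltngtP (f v) 2) => f2.
- have -> : f v = 1 :> nat by lia.
  by apply/card_gt0P; exists v.
(* For a pendant the gap must be at most [f v - 2], so a one-sided window is one index short.
   Starting one index past the host on the other side repairs this, as [f v] is at least 3. *)
- case: (leqP (pos v + f v) d.+1) => h.
    apply: (@size_own _ (pos v).-1) => k kf; rewrite reachE /gap; lia.
  apply: (@size_own _ ((pos v).+2 - f v)) => k kf; rewrite reachE /gap.
  by move: fle; case: ltnP; lia.
case: (boolP (#|pendants (pos v)| == 1)) => p1.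
  have lv : lonely v by rewrite /lonely spv f2 p1.
  apply: (@leq_trans #|[set v; s (spare (pos v))]|).
    rewrite cards2 f2; suff -> : v != s (spare (pos v)) by [].
    by apply: contraNneq spv => ->; rewrite (sp_s coordP) ?spare_le.
  apply/subset_leq_card/subsetP => t /set2P[]-> //.
  by rewrite inE fv lv eqxx !orbT.
(* The host has at least two pendants, all of them charged to [v]. *)
apply: (@leq_trans #|pendants (pos v)|).
  have : 0 < #|pendants (pos v)| by apply/card_gt0P; exists v; rewrite inE spv /=.
  by move: p1; rewrite f2; lia.
apply/subset_leq_card/subsetP => t; rewrite inE => /andP[spt /eqP pt].
rewrite inE fv pt reachE f2 /gap subnn /=; apply/orP; left; rewrite andbT.
by apply: contra spt => /branch_sp.
Qed.

(** If two counted hosts were adjacent, one would be at reach 1 from its own broadcaster and 2 from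
    the other, both of value 2, against [spine_heard_once]. *)
Lemma counted_indep : #|counted| <= indep_num (induced (whole e) R).
Proof.
apply: (leq_bigmax_cond (F := fun S : {set V} => #|S|)).
apply/andP; split.
  by apply/subsetP=> b; rewrite /= setTI inE => /andP[].
apply/forall_inP => b cb; apply/forall_inP => c cc.
apply/negP => /and3P[_ _ ebc].
move: cb cc; rewrite ![_ \in counted]inE => /andP[bR /existsP[v /andP[lv /eqP pv]]].
case/andP=> cR /existsP[w /andP[lw /eqP pw]].
have spb := branch_sp (sparse_branch bR); have spc := branch_sp (sparse_branch cR).
move: ebc; rewrite /= (adjE coordP) spb spc /= => adj_bc.
have [/and3P[spv /eqP fv _] /and3P[spw /eqP fw _]] := (lv, lw).
suff vw : v = w by move: adj_bc; rewrite -pv -pw vw; lia.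
apply: (spine_heard_once (pos_le coordP b)); rewrite ?lonely_gt0 //.
  by rewrite fv /reach spv pv /gap subnn.
by rewrite fw /reach spw pw /gap; lia.
Qed.

Lemma cost_le : cost f <= #|V| - #|B| + indep_num (induced (whole e) R).
Proof.
apply: (@leq_trans #|~: B :|: counted|); last first.
  apply: leq_trans (leq_card_setU _ _) _.
  by rewrite -(cardsC B) addKn leq_add2l counted_indep.
apply: (@leq_trans (\sum_v #|own v|)).
  by apply: leq_sum => v _; apply: card_own.
have <- : #|\bigcup_v own v| = \sum_v #|own v|.
  rewrite -sum1_card partition_disjoint_bigcup.
    by apply: eq_bigr => v _; rewrite sum1_card.
  by move=> v w; apply: own_disjoint.
by apply/subset_leq_card/bigcupsP => v _; apply: own_sub.
Qed.

End Counting.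

Theorem theorem5p3 (V : finType) (e : rel V) (n : nat)
    (hn : #|V| = n) (hC : caterpillar e) :
  alpha_bn e <=
    n - #|branches (whole e)|
      + indep_num (induced (whole e) (sparse_branches e)).
Proof.
have [s [pos [sp coordP]]] := caterpillar_coordinates hC.
rewrite -hn; apply/bigmax_leqP => f /andP[fB fI].
exact: (cost_le coordP fB fI).
Qed.
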